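(* Let $F^*$ be the adjoint of the linearized forward operator $F$ (see context), let $\gamma,\eta\in L^\infty(\mathcal{B}_R)$ with $R=1$, and let $\Lambda=(\Lambda^{\omega_1},\Lambda^{\omega_2})^T=F(\gamma,\eta)^T$. Let $\Phi$ be the discretization of $F^*\Lambda$ and let $\Lambda$ also denote its discretization matrix, as in the context. Then there exists a neural network $\phi^0$ acting on the input $\Lambda$, given by $$\phi^0(\Lambda)=\sum_{i=1}^2 \Big(P_u^T \big(\phi_1^0 R_1^{\omega_i}(\Lambda),\cdots,\phi_1^0 R_{n_\theta}^{\omega_i}(\Lambda) \big)^T P_{\omega_i}+ P_l^T \big(\phi_2^0 R_1^{\omega_i}(\Lambda),\cdots,\phi_2^0 R_{n_\theta}^{\omega_i}(\Lambda)\big)^T P_{\omega_i}\Big),$$ where $(v_1,\cdots,v_{n_\theta})^T$ denotes the matrix whose $m$-th row is the row vector $v_m$, and the shifted inputs $R_m^{\omega}(\Lambda)$, the matrices $P_u,P_l,P_\omega$ and the linear operators $\phi_1^0,\phi_2^0$ are those defined in the context, such that $$|\Phi-\phi^0(\Lambda)|_{\infty}\leq c_{{\bf bf}_0}\, n_\theta^{-1},\qquad c_{{\bf bf}_0}=8\pi^3 (4\omega_2 +3)(|c_{\omega_1}|^2+|c_{\omega_2}|^2)\big(\|\eta\|_{L^1(\mathcal{B}_R)}+ \|\gamma\|_{L^1(\mathcal{B}_R)}\big),$$ where $|\cdot|_\infty$ denotes the maximum magnitude of the entries of a matrix.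
   Context: $\mathbb{S}$ is the unit circle in $\mathbb{R}^2$, $\mathcal{B}_R$ the disc of radius $R$ centred at the origin, $R=1$; $0<\omega_1<\omega_2$ with $\omega_2/\omega_1\in\mathbb{N}$. $\gamma,\eta$ are scalar functions. For $\omega>0$ put $c_\omega=\frac{e^{i\pi/4}\omega^2}{\sqrt{8\pi\omega}}$ and $$[F_1^\omega\gamma](\hat x,\zeta)=-c_\omega\int_{\mathcal{B}_R}(\hat x\cdot\zeta)e^{i\omega(\zeta-\hat x)\cdot y}\gamma(y)\,dy,\qquad [F_2^\omega\eta](\hat x,\zeta)=c_\omega\int_{\mathcal{B}_R}e^{i\omega(\zeta-\hat x)\cdot y}\eta(y)\,dy,\qquad \hat x,\zeta\in\mathbb{S}.$$ $F=\begin{bmatrix} F_1^{\omega_1} & F_2^{\omega_1} \\ F_1^{\omega_2} & F_2^{\omega_2} \end{bmatrix}:(L^2(\mathcal{B}_R))^2\to(L^2(\mathbb{S}\times\mathbb{S}))^2$ with $L^2$ adjoint $F^*\Lambda=\sum_{i=1}^2\begin{bmatrix} F_1^{\omega_i*}\Lambda^{\omega_i} \\ F_2^{\omega_i*}\Lambda^{\omega_i} \end{bmatrix}$, where $$[F_1^{\omega*}\Lambda^\omega](y)=-\overline{c_\omega}\int_{\mathbb{S}\times\mathbb{S}}(\hat x\cdot\zeta)e^{i\omega(\hat x-\zeta)\cdot y}\Lambda^\omega(\hat x,\zeta)\,d\hat x\,d\zeta,\qquad [F_2^{\omega*}\Lambda^\omega](y)=\overline{c_\omega}\int_{\mathbb{S}\times\mathbb{S}}e^{i\omega(\hat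 x-\zeta)\cdot y}\Lambda^\omega(\hat x,\zeta)\,d\hat x\,d\zeta .$$ Points of $\mathbb{S}$ are identified with their angles $\theta_{\hat x},\theta_\zeta$ (mod $2\pi$), and $y=(\rho\cos\theta,\rho\sin\theta)$ with polar coordinates $(\theta,\rho)$. Grids: $n_\theta\le n_\rho$ are positive integers with $n':=\frac{\omega_1}{\omega_2}n_\rho\in\mathbb{N}$. $\theta_m=t_m=\frac{2\pi m}{n_\theta}$ ($1\le m\le n_\theta$) and $\rho_n=\frac{\omega_2}{\omega_1}\frac{n}{n_\rho}$ ($1\le n\le n_\rho$; for the output only $1\le n\le n'$, so $\rho_n\le1$). The discretized input is $\Lambda=\begin{bmatrix} \Lambda^{\omega_1} \\ \Lambda^{\omega_2} \end{bmatrix}\in\mathbb{C}^{2n_\theta\times n_\theta}$ with $\Lambda^\omega[i,j]=\Lambda^\omega(\frac{2\pi i}{n_\theta},\frac{2\pi j}{n_\theta})$. $\Phi\in\mathbb{C}^{2n_\theta\times n'}$ is the discretization of $F^*\Lambda$: its upper (resp. lower) $n_\theta\times n'$ block has $(m,n)$-entry $\sum_{i=1}^2[F_1^{\omega_i*}\Lambda^{\omega_i}](\theta_m,\rho_n)$ (resp. $\sum_{i=1}^2[F_2^{\omega_i*}\Lambda^{\omega_i}](\theta_m,\rho_n)$), where $\Lambda^{\omega_i}$ here is the function. Matrices: $P_u=[I_{n_\theta}\;O_{n_\theta\times n_\theta}]$, $P_l=[O_{n_\theta\times n_\theta}\;I_{n_\theta}]$; $P_\omega\in\mathbb{R}^{n_\rho\times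 n'}$ with $P_\omega[i,j]=1$ if $i=\frac{\omega}{\omega_1}j$ and $0$ otherwise. The shifted inputs $R_m^{\omega}(\Lambda)=\Lambda_{\theta_m}^{\omega}\in\mathbb{C}^{n_\theta\times n_\theta}$, $\omega\in\{\omega_1,\omega_2\}$, are $\Lambda_{\theta_m}^\omega[i,j]=\Lambda^\omega[i+m,j+m]$ with indices mod $n_\theta$; i.e. $R_m^{\omega_1}(\Lambda)=P_{1,\theta_m}P_u\Lambda P_{2,\theta_m}$ and $R_m^{\omega_2}(\Lambda)=P_{1,\theta_m}P_l\Lambda P_{2,\theta_m}$ with $P_{1,\theta_m}=\begin{bmatrix} O_{(n_\theta-m)\times m} & I_{n_\theta-m} \\ I_m & O_{m\times(n_\theta-m)} \end{bmatrix}$, $P_{2,\theta_m}=\begin{bmatrix} O_{m\times(n_\theta-m)} & I_m \\ I_{n_\theta-m} & O_{(n_\theta-m)\times m} \end{bmatrix}$. Weights: $K\in\mathbb{C}^{n_\theta\times n_\rho}$, $K[i,j]=k(t_i,\rho_j)$ with $k(t,\rho)=e^{-i\omega_1\rho\cos t}$; $C\in\mathbb{R}^{n_\theta\times n_\theta}$, $C[i,j]=-\cos(\frac{2\pi(i-j)}{n_\theta})$. With $K^*=\overline{K}^T$, $\odot$ the entrywise product and $\mathrm{diag}(A)$ the row vector of diagonal entries of $A$, the linear operators are $$\phi_1^0\Lambda_{\theta_m}^\omega=\frac{4\pi^2\overline{c_\omega}}{n_\theta^2}\mathrm{diag}\big(K^*(C\odot\Lambda_{\theta_m}^\omega)K\big),\qquad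 \phi_2^0\Lambda_{\theta_m}^\omega=\frac{4\pi^2\overline{c_\omega}}{n_\theta^2}\mathrm{diag}\big(K^*\Lambda_{\theta_m}^\omega K\big)\in\mathbb{C}^{1\times n_\rho}.$$ *)

(* Defs.v *)
From HB Require Import structures.
From mathcomp Require Import all_boot all_order all_algebra.
From mathcomp Require Import all_classical all_reals all_analysis.
From mathcomp Require Import complex.

Set Implicit Arguments.
Unset Strict Implicit.
Unset Printing Implicit Defensive.

Import Order.TTheory GRing.Theory Num.Theory.
Import numFieldNormedType.Exports.

Local Open Scope classical_set_scope.
Local Open Scope ring_scope.
Local Open Scope complex_scope.

Definition cabs (R : realType) (z : R[i]) : R := complex.Re `|z|.

(* e^{i t} for real t *)
Definition expi (R : realType) (t : R) : R[i] := cos t +i* sin t.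

Notation leb2 R := (@lebesgue_measure R \x @lebesgue_measure R)%E.

Definition cintegral (R : realType) (D : set (R * R)) (f : R * R -> R[i]) : R[i] :=
  (\int[leb2 R]_(p in D) complex.Re (f p))
    +i* (\int[leb2 R]_(p in D) complex.Im (f p)).

Definition dot (R : realType) (x y : R * R) : R := x.1 * y.1 + x.2 * y.2.

Definition polar (R : realType) (t r : R) : R * R := (r * cos t, r * sin t).

Definition circ (R : realType) (t : R) : R * R := polar t 1.

Definition disc (R : realType) (r : R) : set (R * R) :=
  [set y | y.1 ^+ 2 + y.2 ^+ 2 <= r ^+ 2].

(* The integral of g (xhat, zeta) for the product of the arc-length measures of
   the unit circle, computed in the angular parametrization. *)
Definition circ2_integral (R : realType) (g : R * R -> R * R -> R[i]) : R[i] :=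
  cintegral (`[0, 2 * pi] `*` `[0, 2 * pi])
    (fun p => g (circ p.1) (circ p.2)).

Definition LpnormC (R : realType) (p : \bar R) (D : set (R * R))
    (f : R * R -> R[i]) : \bar R :=
  'N[leb2 R]_p[(fun y => (cabs (f y))%:E) \_ D]%E.

Definition Linfty (R : realType) (D : set (R * R)) (f : R * R -> R[i]) : Prop :=
  [/\ measurable_fun D (fun y => complex.Re (f y)),
      measurable_fun D (fun y => complex.Im (f y))
    & (LpnormC +oo D f < +oo)%E].

Definition L1norm (R : realType) (D : set (R * R)) (f : R * R -> R[i]) : R :=
  fine (LpnormC 1%E D f).

Definition cw (R : realType) (w : R) : R[i] :=
  expi (pi / 4) * (w ^+ 2 / Num.sqrt (8 * pi * w))%:C.

(* In F1 and F2, B is the disc; x and z stand for xhat and zeta. *)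
Definition F1 (R : realType) (B : set (R * R)) (w : R) (gamma : R * R -> R[i])
    (x z : R * R) : R[i] :=
  - cw w * cintegral B
    (fun y => (dot x z)%:C * expi (w * dot (z - x) y) * gamma y).

Definition F2 (R : realType) (B : set (R * R)) (w : R) (eta : R * R -> R[i])
    (x z : R * R) : R[i] :=
  cw w * cintegral B (fun y => expi (w * dot (z - x) y) * eta y).

Definition forward (R : realType) (B : set (R * R)) (w1 w2 : R)
    (gamma eta : R * R -> R[i]) :
    (R * R -> R * R -> R[i]) * (R * R -> R * R -> R[i]) :=
  (fun x z => F1 B w1 gamma x z + F2 B w1 eta x z,
   fun x z => F1 B w2 gamma x z + F2 B w2 eta x z).

Definition F1adj (R : realType) (w : R) (Lam : R * R -> R * R -> R[i])
    (y : R * R) : R[i] :=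
  - conjc (cw w) * circ2_integral
    (fun x z => (dot x z)%:C * expi (w * dot (x - z) y) * Lam x z).

Definition F2adj (R : realType) (w : R) (Lam : R * R -> R * R -> R[i])
    (y : R * R) : R[i] :=
  conjc (cw w) * circ2_integral
    (fun x z => expi (w * dot (x - z) y) * Lam x z).

Definition adjoint (R : realType) (w1 w2 : R)
    (Lam : (R * R -> R * R -> R[i]) * (R * R -> R * R -> R[i])) :
    (R * R -> R[i]) * (R * R -> R[i]) :=
  (fun y => F1adj w1 Lam.1 y + F1adj w2 Lam.2 y,
   fun y => F2adj w1 Lam.1 y + F2adj w2 Lam.2 y).

(* All mathematical indices start at 1, whereas ordinals start at 0: the ordinal
   i encodes the index i.+1.  The grid functions below take the mathematical
   index; matrix definitions apply them to successors of ordinals. *)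
Definition angle (R : realType) (nt m : nat) : R := 2 * pi * m%:R / nt%:R.

Definition radius (R : realType) (w1 w2 : R) (nr n : nat) : R :=
  w2 / w1 * (n%:R / nr%:R).

Definition sample (R : realType) (nt : nat) (L : R * R -> R * R -> R[i]) :
    'M[R[i]]_nt :=
  \matrix_(i, j) L (circ (angle R nt i.+1)) (circ (angle R nt j.+1)).

Definition discr_input (R : realType) (nt : nat)
    (Lam : (R * R -> R * R -> R[i]) * (R * R -> R * R -> R[i])) :
    'M[R[i]]_(nt + nt, nt) :=
  col_mx (sample nt Lam.1) (sample nt Lam.2).

Definition discr_output (R : realType) (w1 w2 : R) (nt nr n' : nat)
    (f : (R * R -> R[i]) * (R * R -> R[i])) : 'M[R[i]]_(nt + nt, n') :=
  let y (m : 'I_nt) (n : 'I_n') :=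
    polar (angle R nt m.+1) (radius w1 w2 nr n.+1) in
  col_mx (\matrix_(m, n) f.1 (y m n)) (\matrix_(m, n) f.2 (y m n)).

Definition Pu (R : realType) (nt : nat) : 'M[R[i]]_(nt, nt + nt) := row_mx 1%:M 0.

Definition Pl (R : realType) (nt : nat) : 'M[R[i]]_(nt, nt + nt) := row_mx 0 1%:M.

Definition Pfreq (R : realType) (nr n' : nat) (w1 w : R) : 'M[R[i]]_(nr, n') :=
  \matrix_(i, j) ((i.+1%:R == w / w1 * j.+1%:R :> R)%:R).

Definition shift_ord (n m : nat) (i : 'I_n) : 'I_n :=
  Ordinal (ltn_pmod (i + m) (leq_ltn_trans (leq0n i) (ltn_ord i))).

Definition shift_mx (R : realType) (nt m : nat) (A : 'M[R[i]]_nt) : 'M[R[i]]_nt :=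
  \matrix_(i, j) A (shift_ord m i) (shift_ord m j).

Definition Kmx (R : realType) (w1 w2 : R) (nt nr : nat) : 'M[R[i]]_(nt, nr) :=
  \matrix_(i, j) expi (- (w1 * radius w1 w2 nr j.+1 * cos (angle R nt i.+1))).

Definition Cmx (R : realType) (nt : nat) : 'M[R[i]]_nt :=
  \matrix_(i, j) (- cos (2 * pi * (i%:R - j%:R) / nt%:R))%:C.

Definition hadamard (R : realType) (m n : nat) (A B : 'M[R[i]]_(m, n)) :
    'M[R[i]]_(m, n) := map2_mx *%R A B.

Definition diag_row (R : realType) (n : nat) (A : 'M[R[i]]_n) : 'rV[R[i]]_n :=
  \row_j A j j.

Definition adj_mx (R : realType) (m n : nat) (A : 'M[R[i]]_(m, n)) :
    'M[R[i]]_(n, m) := (map_mx conjc A)^T.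

Definition phi1 (R : realType) (w1 w2 w : R) (nt nr : nat) (A : 'M[R[i]]_nt) :
    'rV[R[i]]_nr :=
  let K := Kmx w1 w2 nt nr in
  ((4 * pi ^+ 2 / nt%:R ^+ 2)%:C * conjc (cw w)) *:
    diag_row (adj_mx K *m hadamard (Cmx R nt) A *m K).

Definition phi2 (R : realType) (w1 w2 w : R) (nt nr : nat) (A : 'M[R[i]]_nt) :
    'rV[R[i]]_nr :=
  let K := Kmx w1 w2 nt nr in
  ((4 * pi ^+ 2 / nt%:R ^+ 2)%:C * conjc (cw w)) *:
    diag_row (adj_mx K *m A *m K).

(* A is the block of the input at frequency w. *)
Definition phi0_freq (R : realType) (w1 w2 w : R) (nt nr n' : nat)
    (A : 'M[R[i]]_nt) : 'M[R[i]]_(nt + nt, n') :=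
  (Pu R nt)^T *m (\matrix_(m < nt) phi1 w1 w2 w nr (shift_mx m.+1 A))
      *m Pfreq nr n' w1 w
  + (Pl R nt)^T *m (\matrix_(m < nt) phi2 w1 w2 w nr (shift_mx m.+1 A))
      *m Pfreq nr n' w1 w.

Definition phi0 (R : realType) (w1 w2 : R) (nt nr n' : nat)
    (L : 'M[R[i]]_(nt + nt, nt)) : 'M[R[i]]_(nt + nt, n') :=
  phi0_freq w1 w2 w1 nr n' (Pu R nt *m L)
  + phi0_freq w1 w2 w2 nr n' (Pl R nt *m L).

(* Feed-forward networks: affine layers with entrywise activations between them,
   acting on row vectors. *)
Inductive network (C : nzRingType) : nat -> nat -> Type :=
| OutputLayer m n (W : 'M[C]_(m, n)) (b : 'rV[C]_n) : network C m n
| HiddenLayer m k n (W : 'M[C]_(m, k)) (b : 'rV[C]_k) (act : C -> C)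
    (next : network C k n) : network C m n.

Fixpoint run (C : nzRingType) (m n : nat) (N : network C m n) :
    'rV[C]_m -> 'rV[C]_n :=
  match N in network _ m n return 'rV[C]_m -> 'rV[C]_n with
  | OutputLayer _ _ W b => fun x => x *m W + b
  | HiddenLayer _ _ _ W b act next =>
      fun x => run next (map_mx act (x *m W + b))
  end.

Definition run_mx (C : nzRingType) (m n p q : nat)
    (N : network C (m * n) (p * q)) (A : 'M[C]_(m, n)) : 'M[C]_(p, q) :=
  vec_mx (run N (mxvec A)).

Definition max_entry (R : realType) (m n : nat) (A : 'M[R[i]]_(m, n)) : R :=
  \big[Num.max/0]_(i < m) \big[Num.max/0]_(j < n) cabs (A i j).

Definition cbf0 (R : realType) (w1 w2 : R) (gamma eta : R * R -> R[i]) : R :=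
  8 * pi ^+ 3 * (4 * w2 + 3) * (cabs (cw w1) ^+ 2 + cabs (cw w2) ^+ 2)
    * (L1norm (disc 1) eta + L1norm (disc 1) gamma).

(* Main.v *)
Require Import Defs.
From HB Require Import structures.
From mathcomp Require Import all_boot all_order all_algebra.
From mathcomp Require Import all_classical all_reals all_analysis.
From mathcomp Require Import measurable_realfun ess_sup_inf complex ring lra.

Set Implicit Arguments.
Unset Strict Implicit.
Unset Printing Implicit Defensive.

Import Order.TTheory GRing.Theory Num.Theory.
Import numFieldNormedType.Exports.

Local Open Scope classical_set_scope.
Local Open Scope ring_scope.
Local Open Scope complex_scope.

(** The network is linear, hence a single affine layer. Writing [x], [z] for
    points of the circle, the entries of [phi0] are exactly the n_theta x n_theta
    rectangle rules for the integrals over the torus defining [F^* Lambda]: the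
    shift by [theta_m] and the weights [K], [C] reproduce the integrand at the
    grid points, by periodicity. It remains to bound the quadrature error.
    Substituting the definition of [Lambda], the integrand at frequency [w] is
    [c_w] times an integral over the disc of [eta] and [gamma] against kernels
    [(x . z)^k e^{i w (x - z) . (y - y')}] with [k <= 2] and [|y|, |y'| <= 1].
    Such a kernel is [(1 + 2 w)]-Lipschitz in each angle (for [k = 2] because
    [cos^2] is 1-Lipschitz), and the distance from a point to the corner of its
    cell is at most [2 pi / n_theta] in each angle, which gives the error
    [16 pi^3 (1 + 2 w) |c_w|^2 (|eta|_1 + |gamma|_1) / n_theta], and
    [2 (1 + 2 w) <= 4 w_2 + 3]. *)

(** * Modulus and complex exponential *)

Section complex_exponential.
Variable R : realType.
Implicit Types (z : R[i]) (s t : R).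

Lemma cabsE z : cabs z = Num.sqrt (complex.Re z ^+ 2 + complex.Im z ^+ 2).
Proof. by rewrite /cabs normc_def. Qed.

Lemma normC_cabs z : `|z| = (cabs z)%:C.
Proof. by rewrite cabsE normc_def. Qed.

Lemma cabsM z1 z2 : cabs (z1 * z2) = cabs z1 * cabs z2.
Proof. by apply: complexI; rewrite rmorphM /= -!normC_cabs normrM. Qed.

Lemma cabsN z : cabs (- z) = cabs z.
Proof. by rewrite /cabs normrN. Qed.

Lemma cabs_conjc z : cabs (conjc z) = cabs z.
Proof. by rewrite /cabs normcJ. Qed.

Lemma cabs_ge0 z : 0 <= cabs z.
Proof. by rewrite cabsE sqrtr_ge0. Qed.

Lemma cabs_real t : cabs t%:C = `|t|.
Proof. by rewrite cabsE /= expr0n /= addr0 sqrtr_sqr. Qed.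

Lemma ler_cabsD z1 z2 : cabs (z1 + z2) <= cabs z1 + cabs z2.
Proof. by rewrite -lecR rmorphD /= -!normC_cabs ler_normD. Qed.

Lemma ler_cabsB z1 z2 : cabs (z1 - z2) <= cabs z1 + cabs z2.
Proof. by rewrite -(cabsN z2) ler_cabsD. Qed.

Lemma Re_le_cabs z : `|complex.Re z| <= cabs z.
Proof. by rewrite -lecR -normC_cabs normc_ge_Re. Qed.

Lemma Im_le_cabs z : `|complex.Im z| <= cabs z.
Proof.
by rewrite cabsE -sqrtr_sqr ler_wsqrtr // lerDr sqr_ge0.
Qed.

(** Lets the modulus of an integral be read as the real part of a rotated integral. For nonzero [z]
    the rotation is its conjugate divided by its modulus. *)
Lemma unimodular_rotation z : exists2 u, cabs u = 1 & u * z = (cabs z)%:C.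
Proof.
have [->|z0] := eqVneq z 0.
  by exists 1; rewrite ?mulr0 /cabs ?normr0 ?normr1.
have nz0 : `|z| != 0 by rewrite normr_eq0.
exists (conjc z / `|z|).
  by rewrite /cabs normrM normfV normr_id normcJ divff.
by rewrite mulrAC [conjc z * z]mulrC -sqr_normc expr2 -mulrA divff // mulr1 normC_cabs.
Qed.

Lemma expiD s t : expi (s + t) = expi s * expi t.
Proof. by rewrite /expi cosD sinD; simpc; congr (_ +i* _); rewrite addrC. Qed.

Lemma conjc_expi t : conjc (expi t) = expi (- t).
Proof. by rewrite /expi /= cosN sinN. Qed.

Lemma cabs_expi t : cabs (expi t) = 1.
Proof. by rewrite cabsE /= cos2Dsin2 sqrtr1. Qed.

(** Oddness reduces to [0 <= t], where the mean value theorem on [[0, t]] applies, the derivative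
    being bounded by 1. *)
Lemma ler_norm_sin t : `|sin t| <= `|t|.
Proof.
wlog t0 : t / 0 <= t => [H|].
  case/orP: (le_total 0 t) => [|t0]; first exact: H.
  by rewrite -normrN -sinN -(normrN t) H // oppr_ge0.
have cts : {within `[0, t], continuous (@sin R)}.
  exact/continuous_subspaceT/continuous_sin.
have [c _] := MVT_segment t0 (fun x _ => is_derive_sin x) cts.
rewrite sin0 !subr0 => ->.
by rewrite normrM ler_piMl // cos_max.
Qed.

(* The chord [|e^{is} - e^{it}| = 2 |sin ((s - t) / 2)|] is at most the arc. *)
Lemma expi_lipschitz s t : cabs (expi s - expi t) <= `|s - t|.
Proof.
have -> : cabs (expi s - expi t) = 2 * `|sin ((s - t) / 2)|.
  rewrite cabsE /= -[RHS]ger0_norm ?mulr_ge0 // -sqrtr_sqr; congr Num.sqrt.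
  rewrite exprMn real_normK ?num_real //.
  have := cos_mulr2n ((s - t) / 2); rewrite cos2sin2.
  have -> : (s - t) / 2 *+ 2 = s - t by lra.
  rewrite cosB.
  by have := cos2Dsin2 s; have := cos2Dsin2 t; nra.
by have := ler_norm_sin ((s - t) / 2); rewrite normrM [`|2^-1|]ger0_norm // => ?; lra.
Qed.

Lemma cos_lipschitz s t : `|cos s - cos t| <= `|s - t|.
Proof. exact: le_trans (Re_le_cabs (expi s - expi t)) (expi_lipschitz s t). Qed.

End complex_exponential.

(** * Complex-valued integrals *)

Section complex_integral.
Variable R : realType.
Local Notation mu2 := (leb2 R).
(* On [R * R] itself inference finds a product with another display than that of
   [leb2 R], although the measurable sets are the same. *)
Local Notation T2 := (measurableTypeR R * measurableTypeR R)%type.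
Implicit Types (D : set T2) (f g k : T2 -> R[i]) (c : R[i]).

Definition cintegrable D f :=
  mu2.-integrable D (EFin \o (fun p => complex.Re (f p))) /\
  mu2.-integrable D (EFin \o (fun p => complex.Im (f p))).

Lemma Re_mulc c z : complex.Re (c * z) =
  complex.Re c * complex.Re z - complex.Im c * complex.Im z :> R.
Proof. by case: c; case: z. Qed.

Lemma Im_mulc c z : complex.Im (c * z) =
  complex.Re c * complex.Im z + complex.Im c * complex.Re z :> R.
Proof. by case: c; case: z. Qed.

Lemma Re_subc z1 z2 : complex.Re (z1 - z2) = complex.Re z1 - complex.Re z2 :> R.
Proof. by case: z1; case: z2. Qed.

Lemma Im_subc z1 z2 : complex.Im (z1 - z2) = complex.Im z1 - complex.Im z2 :> R.
Proof. by case: z1; case: z2. Qed.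

(** The real and imaginary parts of a complex multiple or difference are real combinations of this
    shape. *)
Lemma integrable_lincomb D (g h : T2 -> R) (a b : R) :
  measurable D -> mu2.-integrable D (EFin \o g) ->
  mu2.-integrable D (EFin \o h) ->
  mu2.-integrable D (EFin \o (fun p => a * g p + b * h p)).
Proof.
move=> mD ig ih.
have := integrableD mD (integrableZl mD a ig) (integrableZl mD b ih).
by apply: eq_integrable => // p _ /=; rewrite -!EFinM -EFinD.
Qed.

Lemma Rintegral_lincomb D (g h : T2 -> R) (a b : R) :
  measurable D -> mu2.-integrable D (EFin \o g) ->
  mu2.-integrable D (EFin \o h) ->
  \int[mu2]_(p in D) (a * g p + b * h p) =
  a * \int[mu2]_(p in D) g p + b * \int[mu2]_(p in D) h p.
Proof.
move=> mD ig ih; rewrite RintegralD ?RintegralZl //.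
  by have := integrableZl mD a ig; apply: eq_integrable.
by have := integrableZl mD b ih; apply: eq_integrable.
Qed.

Lemma eq_cintegral D f g : {in D, f =1 g} -> cintegral D f = cintegral D g.
Proof.
by move=> fg; congr (_ +i* _); apply: eq_Rintegral => p /fg ->.
Qed.

Lemma cintegrableZ D c f : measurable D -> cintegrable D f ->
  cintegrable D (fun p => c * f p).
Proof.
move=> mD [rf jf]; split.
  have := integrable_lincomb (complex.Re c) (- complex.Im c) mD rf jf.
  by apply: eq_integrable => // p _ /=; rewrite Re_mulc mulNr.
have := integrable_lincomb (complex.Re c) (complex.Im c) mD jf rf.
by apply: eq_integrable => // p _ /=; rewrite Im_mulc.
Qed.

Lemma cintegralZ D c f : measurable D -> cintegrable D f ->
  cintegral D (fun p => c * f p) = c * cintegral D f.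
Proof.
move=> mD [rf jf]; apply/eqP; rewrite eq_complex Re_mulc Im_mulc /=; apply/andP; split.
  under eq_Rintegral do rewrite Re_mulc -mulNr.
  by rewrite Rintegral_lincomb // mulNr.
under eq_Rintegral do rewrite Im_mulc.
by rewrite Rintegral_lincomb.
Qed.

Lemma cintegrableB D f g : measurable D -> cintegrable D f ->
  cintegrable D g -> cintegrable D (fun p => f p - g p).
Proof.
move=> mD [rf jf] [rg jg]; split.
  have := integrable_lincomb 1 (- 1) mD rf rg.
  by apply: eq_integrable => // p _ /=; rewrite Re_subc mul1r mulN1r.
have := integrable_lincomb 1 (- 1) mD jf jg.
by apply: eq_integrable => // p _ /=; rewrite Im_subc mul1r mulN1r.
Qed.

Lemma cintegralB D f g : measurable D -> cintegrable D f -> cintegrable D g ->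
  cintegral D (fun p => f p - g p) = cintegral D f - cintegral D g.
Proof.
move=> mD [rf jf] [rg jg]; apply/eqP; rewrite eq_complex Re_subc Im_subc /=.
under eq_Rintegral do rewrite Re_subc.
under [X in _ && (X == _)]eq_Rintegral do rewrite Im_subc.
by rewrite !RintegralB // !eqxx.
Qed.

(** After rotation by a unimodular [u], the modulus of the integral is the integral of the real part
    of [u * f], which is pointwise at most [cabs (f p)]. *)
Lemma cabs_cintegral_le D f (g : T2 -> R) : measurable D ->
  cintegrable D f -> mu2.-integrable D (EFin \o g) ->
  (forall p, D p -> cabs (f p) <= g p) ->
  cabs (cintegral D f) <= \int[mu2]_(p in D) g p.
Proof.
move=> mD intf intg fg.
have [u u1 uE] := unimodular_rotation (cintegral D f).
have [iuf _] := cintegrableZ u mD intf.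
rewrite -[cabs _]/(complex.Re (cabs (cintegral D f))%:C) -uE -cintegralZ //=.
apply: le_Rintegral => // p Dp.
apply: le_trans (fg p Dp); rewrite -[cabs (f p)]mul1r -u1 -cabsM.
exact: le_trans (ler_norm _) (Re_le_cabs _).
Qed.

Lemma cintegrable_boundedM D f k (M : R) : measurable D -> cintegrable D f ->
  measurable_fun D (fun p => complex.Re (k p)) ->
  measurable_fun D (fun p => complex.Im (k p)) ->
  (forall p, D p -> cabs (k p) <= M) ->
  cintegrable D (fun p => k p * f p).
Proof.
move=> mD [rf jf] mrk mik kM.
have bk (h : R[i] -> R) : (forall z, `|h z| <= cabs z) ->
    [bounded h (k p) | p in D].
  move=> hz; exists M; split; first exact: num_real.
  by move=> x Mx p /= Dp; rewrite (le_trans (hz _)) // (le_trans (kM _ Dp)) // ltW.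
have brk := bk _ (@Re_le_cabs R); have bik := bk _ (@Im_le_cabs R).
split.
  have := integrableB mD (integrableMr mD mrk brk rf) (integrableMr mD mik bik jf).
  by apply: eq_integrable => // p _ /=; rewrite Re_mulc EFinB !EFinM.
have := integrableD mD (integrableMr mD mrk brk jf) (integrableMr mD mik bik rf).
by apply: eq_integrable => // p _ /=; rewrite Im_mulc EFinD !EFinM.
Qed.

Lemma measurable_cabs D f : measurable_fun D (fun p => complex.Re (f p)) ->
  measurable_fun D (fun p => complex.Im (f p)) ->
  measurable_fun D (fun p => cabs (f p)).
Proof.
move=> mr mi; under eq_fun do rewrite cabsE.
apply: (measurableT_comp (continuous_measurable_fun (@sqrt_continuous R))).
by apply: measurable_funD; exact: measurable_funX.
Qed.

(** A finite essential supremum bounds [f] almost everywhere by a constant, which is integrable on a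
    set of finite measure. *)
Lemma Linfty_integrable D f : measurable D -> (mu2 D < +oo)%E -> Linfty D f ->
  mu2.-integrable D (EFin \o (fun p => cabs (f p))).
Proof.
move=> mD Doo [mr mi foo].
have mf : measurable_fun D (fun p => cabs (f p)) by exact: measurable_cabs.
have [M M0 fM] : exists2 M : R, 0 <= M &
    {ae mu2, forall p, D p -> ((cabs (f p))%:E <= M%:E)%E}.
  move: foo; rewrite /LpnormC unlock /Lnorm; case: ifPn => [_|mu0 _]; last first.
    (* The norm at [+oo] is 0 by convention when the whole space has measure zero; then the
       exceptional set may be everything. *)
    exists 0 => //; exists setT; split => //.
    by apply/eqP; rewrite eq_le measure_ge0 andbT leNgt.
  set s := ess_sup _ _ => soo.
  (* The maximum with 0 makes the bound nonnegative and also covers [s = -oo], where [fine s] is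
     0. *)
  have sge : (s <= (Num.max 0 (fine s))%:E)%E.
    by case: s soo => [r|//|//] _ /=; rewrite ?lee_fin ?le_max ?lexx ?orbT ?leNye.
  exists (Num.max 0 (fine s)); first by rewrite le_max lexx.
  have := @ess_sup_ge _ _ _ mu2 (abse \o (fun y => (cabs (f y))%:E) \_ D).
  apply: filterS => p /= + Dp; rewrite patchE mem_set //= ger0_norm ?cabs_ge0 // => H.
  exact: le_trans H sge.
apply/integrableP; split; first exact/measurable_EFinP.
under eq_integral do rewrite /= ger0_norm ?cabs_ge0 //.
apply: (@le_lt_trans _ _ (\int[mu2]_(p in D) (M%:E))%E); last first.
  by rewrite integral_cst // lte_mul_pinfty // ?lee_fin.
apply: ae_ge0_le_integral => //.
- by move=> p _; rewrite lee_fin cabs_ge0.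
- exact/measurable_EFinP.
Qed.

Lemma integrable_cintegrable D f : measurable D ->
  measurable_fun D (fun p => complex.Re (f p)) ->
  measurable_fun D (fun p => complex.Im (f p)) ->
  mu2.-integrable D (EFin \o (fun p => cabs (f p))) -> cintegrable D f.
Proof.
move=> mD mr mi H; split; apply: le_integrable H => //.
- exact/measurable_EFinP.
- by move=> p _ /=; rewrite lee_fin [leRHS]ger0_norm ?cabs_ge0 ?Re_le_cabs.
- exact/measurable_EFinP.
- by move=> p _ /=; rewrite lee_fin [leRHS]ger0_norm ?cabs_ge0 ?Im_le_cabs.
Qed.

Lemma L1normE D f : L1norm D f = \int[mu2]_(p in D) cabs (f p).
Proof.
rewrite /L1norm /LpnormC Lnorm1 /Rintegral [in RHS]integral_mkcond; congr fine.
apply: eq_integral => p _; rewrite !patchE; case: ifPn => _ //=.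
  by rewrite ger0_norm ?cabs_ge0.
by rewrite normr0.
Qed.

End complex_integral.

(** * Rectangle rule on the torus *)

Section quadrature.
Variable R : realType.
Local Notation mu2 := (leb2 R).
Local Notation T1 := (measurableTypeR R).
Local Notation T2 := (measurableTypeR R * measurableTypeR R)%type.
Implicit Types (n : nat) (t : R).

(* Only the cell of index 0 contains its left end point, so that the cells form
   a partition of [[0, 2 pi]]. *)
Definition cell n (i : nat) : set T1 :=
  [set` Interval (if i == 0%N then BLeft 0 else BRight (angle R n i))
                 (BRight (angle R n i.+1))].

Lemma cellP n i t : cell n i t ->
  [/\ 0 <= t, angle R n i <= t, t <= angle R n i.+1 & i != 0%N -> angle R n i < t].
Proof.
have a0 m : 0 <= angle R n m by rewrite /angle !mulr_ge0 ?invr_ge0 ?pi_ge0.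
rewrite /cell /= in_itv /=; case: (eqVneq i 0%N) => [->|_] /andP[it ti]; split => //.
- by rewrite /angle mulr0 mul0r.
- exact: le_trans (a0 i) (ltW it).
- exact: ltW.
Qed.

Lemma angleS n i : angle R n i.+1 = angle R n i + 2 * pi / n%:R.
Proof. by rewrite /angle -natr1; ring. Qed.

Lemma ler_angle n i j : (i <= j)%N -> angle R n i <= angle R n j.
Proof.
move=> ij; rewrite ler_wpM2r ?invr_ge0 // ler_wpM2l ?ler_nat //.
by rewrite mulr_ge0 // pi_ge0.
Qed.

Lemma angle_full n : (0 < n)%N -> angle R n n = 2 * pi.
Proof. by move=> n0; rewrite /angle mulfK // pnatr_eq0 -lt0n. Qed.

Lemma cell_dist n i t : cell n i t -> `|t - angle R n i.+1| <= 2 * pi / n%:R.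
Proof.
move=> /cellP[_ it ti _]; rewrite distrC ger0_norm ?subr_ge0 //.
by rewrite angleS; lra.
Qed.

Lemma cell_subset n (i : 'I_n) t : cell n i t -> t \in `[0, 2 * pi].
Proof.
move=> /cellP[t0 _ ti _]; rewrite in_itv /= t0 /=.
have n0 : (0 < n)%N by exact: leq_ltn_trans (ltn_ord i).
by rewrite (le_trans ti) // -(angle_full n0) ler_angle.
Qed.

(** For [i < j] the right end of cell [i] is at most the left end of cell [j], which cell [j] omits
    because [j] is nonzero. *)
Lemma cell_inj n i j t : cell n i t -> cell n j t -> i = j.
Proof.
wlog ij : i j / (i < j)%N => [H ti tj|].
  by case: (ltngtP i j) => // ij; [exact: H | apply/esym; exact: H].
move=> /cellP[_ _ ti _] /cellP[_ _ _ jt].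
have := lt_le_trans (jt (lt0n_neq0 (leq_ltn_trans (leq0n i) ij))) ti.
by rewrite ltNge ler_angle.
Qed.

(** The cell is the one with the least [i] such that [t <= angle R n i.+1]; minimality yields the
    strict lower bound when [i] is nonzero. *)
Lemma cell_cover n t : (0 < n)%N -> t \in `[0, 2 * pi] -> exists i : 'I_n, cell n i t.
Proof.
move=> n0; rewrite in_itv /= => /andP[t0 tpi].
have ex : exists i, t <= angle R n i.+1.
  by exists n.-1; rewrite prednK // angle_full.
case: (ex_minnP ex) => i ti imin.
have iltn : (i < n)%N.
  apply: (@leq_ltn_trans n.-1); last by rewrite prednK.
  by apply: imin; rewrite prednK // angle_full.
exists (Ordinal iltn); rewrite /cell /= in_itv /= ti andbT.
case: (i) imin => [//|k] kmin /=; rewrite ltNge; apply/negP => /kmin.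
by rewrite ltnn.
Qed.

Lemma measurable_cell n i : measurable (cell n i).
Proof. exact: measurable_itv. Qed.

Lemma lebesgue_cell n i : (0 < n)%N ->
  @lebesgue_measure R (cell n i) = (2 * pi / n%:R)%:E.
Proof.
move=> n0; have h0 : 0 < 2 * pi / n%:R :> R.
  by rewrite divr_gt0 ?ltr0n // mulr_gt0 // pi_gt0.
rewrite /cell lebesgue_measure_itv /=; case: (eqVneq i 0%N) => [->|_] /=.
  have a0 : angle R n 0 = 0 by rewrite /angle mulr0 mul0r.
  by rewrite angleS a0 add0r lte_fin h0 oppr0 -EFinD addr0.
by rewrite lte_fin angleS ltrDl h0 -EFinD addrAC subrr add0r.
Qed.

Local Notation cell2 n k := (cell n k.1 `*` cell n k.2).
Local Notation square := (`[0, 2 * pi] `*` `[0, 2 * pi] : set T2).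

Lemma measurable_cell2 n (k : nat * nat) : measurable (cell2 n k : set T2).
Proof. by apply: measurableX; exact: measurable_cell. Qed.

Lemma measurable_square : measurable square.
Proof. by apply: measurableX; exact: measurable_itv. Qed.

Lemma mu2_square : mu2 square = (4 * pi ^+ 2)%:E.
Proof.
have itvE : @lebesgue_measure R `[0, 2 * pi] = (2 * pi)%:E.
  rewrite lebesgue_measure_itv /= lte_fin mulr_gt0 ?pi_gt0 //.
  by rewrite oppr0 -EFinD addr0.
rewrite product_measure1E; try exact: measurable_itv.
transitivity ((2 * pi)%:E * (2 * pi)%:E : \bar R)%E; first by congr (_ * _)%E.
by rewrite -EFinM; congr (_%:E); ring.
Qed.

Lemma mu2_cell2 n (k : nat * nat) : (0 < n)%N ->
  mu2 (cell2 n k) = (4 * pi ^+ 2 / n%:R ^+ 2)%:E.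
Proof.
move=> n0; rewrite product_measure1E; try exact: measurable_cell.
transitivity ((2 * pi / n%:R)%:E * (2 * pi / n%:R)%:E : \bar R)%E.
  by congr (_ * _)%E; exact: lebesgue_cell.
rewrite -EFinM; congr (_%:E); field.
by rewrite pnatr_eq0 -lt0n.
Qed.

(** A finite sum of indicators, so that integrability and the integral are obtained term by term. *)
Definition step n (v : 'I_n -> 'I_n -> R) (p : T2) : R :=
  \sum_(k : 'I_n * 'I_n) v k.1 k.2 * \1_(cell2 n k) p.

Lemma stepE n v (i j : 'I_n) (p : T2) :
  cell n i p.1 -> cell n j p.2 -> step v p = v i j.
Proof.
move=> ip jp; rewrite /step (bigD1 (i, j)) //= big1 => [|[i' j'] ne].
  by rewrite indicE mem_set // mulr1 addr0.
rewrite indicE memNset ?mulr0 //= => -[i'p j'p]; case/eqP: ne.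
by congr (_, _); apply: val_inj; [exact: cell_inj i'p ip | exact: cell_inj j'p jp].
Qed.

Lemma integrable_indic_cell2 n (k : nat * nat) :
  mu2.-integrable square (EFin \o \1_(cell2 n k : set T2)).
Proof.
have fin_square : (mu2 square < +oo)%E by rewrite mu2_square ltry.
apply: (measurable_bounded_integrable measurable_square fin_square).
- by apply: measurable_indic; exact: measurable_cell2.
- exists 1; split; first exact: num_real.
  move=> x x1 p _ /=; rewrite (le_trans _ (ltW x1)) // indicE.
  by case: (_ \in _); rewrite ?normr1 ?normr0.
Qed.

Lemma integrable_step n (v : 'I_n -> 'I_n -> R) :
  mu2.-integrable square (EFin \o step v).
Proof.
have : mu2.-integrable square (fun p =>
    \sum_(k : 'I_n * 'I_n) ((v k.1 k.2)%:E * (\1_(cell2 n k) p)%:E))%E.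
  apply: integrable_sum; first exact: measurable_square.
  move=> k _; apply: integrableZl; first exact: measurable_square.
  exact: (integrable_indic_cell2 n (val k.1, val k.2)).
apply: eq_integrable; first exact: measurable_square.
by move=> p _ /=; rewrite /step -sumEFin; apply: eq_bigr => k _; rewrite EFinM.
Qed.

Lemma Rintegral_step n (v : 'I_n -> 'I_n -> R) : (0 < n)%N ->
  \int[mu2]_(p in square) step v p =
  4 * pi ^+ 2 / n%:R ^+ 2 * \sum_i \sum_j v i j.
Proof.
move=> n0; have ms := measurable_square.
have ik (k : 'I_n * 'I_n) : mu2.-integrable square
    (fun p => (v k.1 k.2)%:E * (\1_(cell2 n k) p)%:E)%E.
  apply: integrableZl => //.
  exact: (integrable_indic_cell2 n (val k.1, val k.2)).
rewrite /Rintegral.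
under eq_integral => p _.
  rewrite /step -sumEFin; under eq_bigr do rewrite EFinM.
  over.
rewrite integral_sum // pair_bigA mulr_sumr /=.
under eq_bigr => k _.
  rewrite integralZl //; last exact: (integrable_indic_cell2 n (val k.1, val k.2)).
  rewrite integral_indic //; last exact: (measurable_cell2 n (val k.1, val k.2)).
  (* Each cell lies inside the square, so restricting to the square does not change its measure. *)
  rewrite setIidl; last by move=> p [/= /cell_subset + /cell_subset].
  rewrite (_ : _ (_ `*` _) = (4 * pi ^+ 2 / n%:R ^+ 2)%:E); last first.
    exact: (mu2_cell2 (val k.1, val k.2)).
  rewrite -EFinM.
  over.
by rewrite sumEFin /=; apply: eq_bigr => k _; rewrite mulrC.
Qed.

Definition cstep n (v : 'I_n -> 'I_n -> R[i]) (p : T2) : R[i] :=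
  step (fun i j => complex.Re (v i j)) p +i* step (fun i j => complex.Im (v i j)) p.

Lemma cstepE n v (i j : 'I_n) (p : T2) :
  cell n i p.1 -> cell n j p.2 -> cstep v p = v i j.
Proof.
move=> ip jp; rewrite /cstep (stepE _ ip jp) (stepE _ ip jp).
by case: (v i j).
Qed.

(** The rectangle rule is the exact integral of the step function of node values, so its error is
    the integral of a pointwise difference. *)
Lemma cintegral_cstep n (v : 'I_n -> 'I_n -> R[i]) : (0 < n)%N ->
  cintegral square (cstep v) =
  (4 * pi ^+ 2 / n%:R ^+ 2)%:C * \sum_i \sum_j v i j.
Proof.
move=> n0; apply/eqP; rewrite eq_complex Re_mulc Im_mulc /= !mul0r subr0 addr0.
(* Stated for any additive [f], to serve both the real and the imaginary part. *)
have sumE (f : R[i] -> R) : f 0 = 0 -> {morph f : x y / x + y} ->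
    f (\sum_i \sum_j v i j) = \sum_i \sum_j f (v i j).
  move=> f0 fD; rewrite (big_morph f fD f0).
  by apply: eq_bigr => i _; rewrite (big_morph f fD f0).
by rewrite !Rintegral_step // !sumE ?eqxx // => -[? ?] [].
Qed.

(** The node is the upper corner of the cell, at most [2 pi / n] away in each of the two angles. *)
Lemma node_dist n L (F : R -> R -> R[i]) (p : T2) (i j : 'I_n) : 0 <= L ->
  (forall a b a0 b0, cabs (F a b - F a0 b0) <= L * (`|a - a0| + `|b - b0|)) ->
  cell n i p.1 -> cell n j p.2 ->
  cabs (F p.1 p.2 - F (angle R n i.+1) (angle R n j.+1)) <= L * (4 * pi / n%:R).
Proof.
move=> L0 FL /cell_dist ip /cell_dist jp; apply: le_trans (FL _ _ _ _) _.
rewrite ler_wpM2l // (_ : 4 * pi / n%:R = 2 * pi / n%:R + 2 * pi / n%:R) ?lerD //.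
by ring.
Qed.

(* [F] is the uniform limit of its step functions on finer and finer grids. *)
Lemma measurable_lipschitz (h : R[i] -> R) (F : R -> R -> R[i]) L : 0 <= L ->
  (forall a b a0 b0, cabs (F a b - F a0 b0) <= L * (`|a - a0| + `|b - b0|)) ->
  (forall z1 z2, `|h z1 - h z2| <= cabs (z1 - z2)) ->
  measurable_fun square (fun p : T2 => h (F p.1 p.2)).
Proof.
move=> L0 FL hle.
pose s m := @step m.+1 (fun i j => h (F (angle R m.+1 i.+1) (angle R m.+1 j.+1))).
apply: (@measurable_fun_cvg _ _ _ _ s).
  move=> m; apply/measurable_EFinP.
  exact: measurable_int (integrable_step _).
move=> p [/= /(cell_cover (ltn0Sn _)) p1 /(cell_cover (ltn0Sn _)) p2].
apply/cvgrPdist_le => e e0.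
(* The summand 1 keeps [C] positive when [L] is 0, so that [e / C] is a legitimate threshold. *)
pose C := L * (4 * pi) + 1.
have C0 : 0 < C by rewrite ltr_wpDl // !mulr_ge0 // pi_ge0.
near=> m; have [i ip] := p1 m; have [j jp] := p2 m.
rewrite /s (stepE _ ip jp) (le_trans (hle _ _)) // (le_trans (node_dist L0 FL ip jp)) //.
have mC : m.+1%:R^-1 <= e / C.
  near: m; apply: filterS (near_infty_natSinv_lt (PosNum (divr_gt0 e0 C0))).
  by move=> m /ltW.
rewrite ler_pdivlMr // in mC.
rewrite mulrA (le_trans _ mC) // mulrC ler_wpM2l ?invr_ge0 //.
by rewrite lerDl.
Unshelve. all: by end_near.
Qed.

(** The pointwise error [4 pi L / n] is integrated over a square of area [4 pi^2]. *)
Lemma quadrature_error n L (F : R -> R -> R[i]) : (0 < n)%N -> 0 <= L ->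
  (forall a b a0 b0, cabs (F a b - F a0 b0) <= L * (`|a - a0| + `|b - b0|)) ->
  cabs (cintegral square (fun p => F p.1 p.2) -
        (4 * pi ^+ 2 / n%:R ^+ 2)%:C *
        \sum_(i < n) \sum_(j < n) F (angle R n i.+1) (angle R n j.+1))
  <= 16 * pi ^+ 3 * L / n%:R.
Proof.
move=> n0 L0 FL; have ms := measurable_square.
have cst_int (c : R) : mu2.-integrable square (EFin \o (fun=> c)).
  have fin_square : (mu2 square < +oo)%E by rewrite mu2_square ltry.
  apply: (measurable_bounded_integrable ms fin_square); first exact: measurable_cst.
  exact: bounded_cst.
pose v (i j : 'I_n) := F (angle R n i.+1) (angle R n j.+1).
have dv (p : T2) : square p ->
    cabs (F p.1 p.2 - cstep v p) <= L * (4 * pi / n%:R).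
  move=> [/= /(cell_cover n0)[i ip] /(cell_cover n0)[j jp]].
  by rewrite (cstepE _ ip jp) node_dist.
have int_v : cintegrable square (cstep v) by split; exact: integrable_step.
have hRe z1 z2 : `|complex.Re z1 - complex.Re z2| <= cabs (z1 - z2) :> R.
  by rewrite -Re_subc Re_le_cabs.
have hIm z1 z2 : `|complex.Im z1 - complex.Im z2| <= cabs (z1 - z2) :> R.
  by rewrite -Im_subc Im_le_cabs.
(* [F] is measurable as a Lipschitz function, and bounded because both angles are at most [2 pi]
   away from 0. *)
have int_F : cintegrable square (fun p : T2 => F p.1 p.2).
  have Foo : mu2.-integrable square
      (EFin \o (fun p : T2 => cabs (F 0 0) + L * (4 * pi))) by exact: cst_int.
  have Fle (p : T2) : square p -> cabs (F p.1 p.2) <= cabs (F 0 0) + L * (4 * pi).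
    move=> [/=]; rewrite !in_itv /= => /andP[p10 p1] /andP[p20 p2].
    rewrite -(subrK (F 0 0) (F _ _)) addrC (le_trans (ler_cabsD _ _)) // lerD2l.
    rewrite (le_trans (FL _ _ _ _)) // ler_wpM2l // !subr0 !ger0_norm //; lra.
  split; apply: (le_integrable ms _ _ Foo).
  - by apply/measurable_EFinP; exact: (measurable_lipschitz L0 FL hRe).
  - move=> p Dp; rewrite lee_fin (le_trans (Re_le_cabs _)) //.
    by rewrite (le_trans (Fle _ Dp)) // ler_norm.
  - by apply/measurable_EFinP; exact: (measurable_lipschitz L0 FL hIm).
  - move=> p Dp; rewrite lee_fin (le_trans (Im_le_cabs _)) //.
    by rewrite (le_trans (Fle _ Dp)) // ler_norm.
rewrite -(cintegral_cstep v n0) -cintegralB //.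
apply: le_trans (cabs_cintegral_le ms (cintegrableB ms int_F int_v) (cst_int _) dv) _.
rewrite Rintegral_cst // (_ : fine _ = 4 * pi ^+ 2); last first.
  by rewrite -[RHS]/(fine (4 * pi ^+ 2)%:E); congr fine; exact: mu2_square.
rewrite [leLHS](_ : _ = 16 * pi ^+ 3 * L / n%:R) //.
by field; rewrite pnatr_eq0 -lt0n.
Qed.

End quadrature.

(** * Linearity of the network *)

Section network_realization.
Variable R : realType.
Local Notation C := R[i].

Lemma shift_mx_linear nt m : linear (@shift_mx R nt m).
Proof. by move=> a A B; apply/matrixP => i j; rewrite !mxE. Qed.

Lemma hadamard_linear m n (H : 'M[C]_(m, n)) : linear (hadamard H).
Proof. by move=> a A B; apply/matrixP => i j; rewrite !mxE mulrDr mulrCA. Qed.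

Lemma diag_row_linear n : linear (@diag_row R n).
Proof. by move=> a A B; apply/matrixP => i j; rewrite !mxE. Qed.

Lemma phi2_linear (w1 w2 w : R) nt nr : linear (@phi2 R w1 w2 w nt nr).
Proof.
move=> a A B; rewrite /phi2 mulmxDr mulmxDl -scalemxAr -scalemxAl.
by rewrite diag_row_linear scalerDr !scalerA mulrC.
Qed.

Lemma phi1_linear (w1 w2 w : R) nt nr : linear (@phi1 R w1 w2 w nt nr).
Proof.
move=> a A B; rewrite /phi1 hadamard_linear mulmxDr mulmxDl -scalemxAr -scalemxAl.
by rewrite diag_row_linear scalerDr !scalerA mulrC.
Qed.

Lemma rows_linear p q (a : C) (u v t : 'I_p -> 'rV[C]_q) :
  (forall i, t i = a *: u i + v i) ->
  \matrix_(i < p) t i = a *: (\matrix_(i < p) u i) + \matrix_(i < p) v i.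
Proof. by move=> tE; apply/matrixP => i j; rewrite !mxE tE !mxE. Qed.

Lemma stack_linear (U : lmodType C) nt nr n' (f g : U -> 'M[C]_(nt, nr))
    (P : 'M[C]_(nr, n')) : linear f -> linear g ->
  linear (fun A => (Pu R nt)^T *m f A *m P + (Pl R nt)^T *m g A *m P).
Proof.
move=> fl gl a A B; rewrite fl gl !mulmxDr !mulmxDl -!scalemxAr -!scalemxAl.
by rewrite scalerDr addrACA.
Qed.

Lemma phi0_freq_linear (w1 w2 w : R) nt nr n' :
  linear (@phi0_freq R w1 w2 w nt nr n').
Proof.
apply: (@stack_linear _ nt nr n'
  (fun A => \matrix_(m < nt) phi1 w1 w2 w nr (shift_mx m.+1 A))
  (fun A => \matrix_(m < nt) phi2 w1 w2 w nr (shift_mx m.+1 A))) => a A B.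
- by apply: rows_linear => i; rewrite shift_mx_linear phi1_linear.
- by apply: rows_linear => i; rewrite shift_mx_linear phi2_linear.
Qed.

Lemma phi0_linear (w1 w2 : R) nt nr n' : linear (@phi0 R w1 w2 nt nr n').
Proof.
move=> a A B; rewrite /phi0 !mulmxDr -!scalemxAr !phi0_freq_linear.
by rewrite addrACA [in RHS]scalerDr.
Qed.

(** On flattened matrices a linear map is multiplication by a matrix: one output layer with zero
    bias. *)
Lemma linear_network m n p q (f : 'M[C]_(m, n) -> 'M[C]_(p, q)) : linear f ->
  exists N : network C (m * n) (p * q), forall A, run_mx N A = f A.
Proof.
move=> fl.
pose F : {linear 'M[C]_(m, n) -> 'M[C]_(p, q)} :=
  HB.pack f (GRing.isLinear.Build _ _ _ _ f fl).
exists (OutputLayer (lin_mx F) 0) => A.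
by rewrite -[LHS]/(vec_mx (mxvec A *m lin_mx F + 0)) addr0 mul_vec_lin mxvecK.
Qed.

End network_realization.

(** * Entries of the network output *)

Section matrix_entries.
Variable R : realType.
Local Notation C := R[i].

(** The transposes of [Pu] and [Pl] pad a block with zero rows, below and above respectively. *)
Lemma embed_upper_lower nr n' nt (A B : 'M[C]_(nt, nr)) (P : 'M[C]_(nr, n')) :
  (Pu R nt)^T *m A *m P + (Pl R nt)^T *m B *m P = col_mx (A *m P) (B *m P).
Proof.
rewrite /Pu /Pl !tr_row_mx !trmx0 !trmx1 !mul_col_mx !mul1mx !mul0mx add_col_mx.
by rewrite addr0 add0r.
Qed.

Lemma phi0_discr_input (w1 w2 : R) nt nr n' (A1 A2 : 'M[C]_nt) :
  phi0 w1 w2 nr n' (col_mx A1 A2) =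
  phi0_freq w1 w2 w1 nr n' A1 + phi0_freq w1 w2 w2 nr n' A2.
Proof.
by rewrite /phi0 /Pu /Pl !mul_row_col !mul1mx !mul0mx addr0 add0r.
Qed.

(** Column [n] of [Pfreq] has its only 1 in row [i0], so the product selects column [i0] of [A]. *)
Lemma mul_Pfreq nt nr n' (w1 w : R) (A : 'M[C]_(nt, nr)) m (n : 'I_n') (i0 : 'I_nr) :
  i0.+1%:R = w / w1 * n.+1%:R -> (A *m Pfreq nr n' w1 w) m n = A m i0.
Proof.
move=> i0E; rewrite mxE (bigD1 i0) //= big1 => [|i ne].
  by rewrite mxE i0E eqxx mulr1 addr0.
rewrite mxE -i0E eqr_nat eqSS (inj_eq val_inj) (negbTE ne) mulr0 //.
Qed.

(** An injective self-map of a finite set is a bijection, so sums over the grid may be reindexed by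
    the shift. *)
Lemma shift_ord_inj n m : injective (@shift_ord n m).
Proof.
move=> i j /(congr1 val) /= /eqP; rewrite eqn_modDr => /eqP.
by rewrite !modn_small // => /val_inj.
Qed.

Lemma cos_period n (x : R) : cos (x + 2 * pi * n%:R) = cos x.
Proof.
rewrite (_ : 2 * pi * n%:R = (pi *+ 2) *+ n); first by rewrite periodicn //; exact: cosD2pi.
by rewrite -(mulr_natr (pi *+ 2)) -(mulr_natl pi).
Qed.

Lemma sin_period n (x : R) : sin (x + 2 * pi * n%:R) = sin x.
Proof.
rewrite (_ : 2 * pi * n%:R = (pi *+ 2) *+ n); first by rewrite periodicn //; exact: sinD2pi.
by rewrite -(mulr_natr (pi *+ 2)) -(mulr_natl pi).
Qed.

(** Reduction modulo [nt] drops [(i + m) %/ nt] full turns. The successor stays outside the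
    reduction, which changes the index only by a multiple of [nt]. *)
Lemma circ_shift_ord nt m (i : 'I_nt) :
  circ (angle R nt (shift_ord m i).+1) = circ (angle R nt i.+1 + angle R nt m).
Proof.
have nt0 : nt%:R != 0 :> R by rewrite pnatr_eq0 -lt0n (leq_ltn_trans _ (ltn_ord i)).
have -> : angle R nt i.+1 + angle R nt m =
    angle R nt (shift_ord m i).+1 + 2 * pi * ((i + m) %/ nt)%:R.
  have : (i.+1 + m)%:R = ((shift_ord m i).+1 + (i + m) %/ nt * nt)%:R :> R.
    by rewrite !addSn [in LHS](divn_eq (i + m) nt) addnC.
  rewrite !natrD natrM /angle => E.
  by rewrite -mulrDl -mulrDr E; field.
by rewrite /circ /polar cos_period sin_period.
Qed.

Lemma dot_circ (a b : R) : dot (circ a) (circ b) = cos (a - b).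
Proof. by rewrite /dot /= !mul1r cosB. Qed.

Lemma dot_polar (a t r : R) : dot (circ a) (polar t r) = r * cos (a - t).
Proof. by rewrite /dot /= !mul1r cosB; ring. Qed.

Lemma dotBl (x z y : R * R) : dot (x - z) y = dot x y - dot z y.
Proof. by rewrite /dot /=; ring. Qed.

(** * A single output entry at one frequency, as a rectangle rule *)

Section entries.
Variables (w1 w2 w : R) (nt nr n' : nat) (L : R * R -> R * R -> R[i]).
Variables (m : 'I_nt) (n : 'I_n') (i0 : 'I_nr).
Hypothesis i0E : i0.+1%:R = w / w1 * n.+1%:R :> R.
Hypothesis w1_neq0 : w1 != 0.
Let y := polar (angle R nt m.+1) (Defs.radius w1 w2 nr n.+1).
Let x i := circ (angle R nt i.+1).

(** [Kmx] involves only the frequency [w1]; reading it at a radius [w / w1] times larger produces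
    the frequency [w]. *)
Lemma radius_freq : w1 * Defs.radius w1 w2 nr i0.+1 = w * Defs.radius w1 w2 nr n.+1.
Proof.
have nr0 : nr%:R != 0 :> R by rewrite pnatr_eq0 -lt0n (leq_ltn_trans _ (ltn_ord i0)).
by rewrite /Defs.radius i0E; field; rewrite w1_neq0 nr0.
Qed.

(** The shift adds the angle of [y] to that of the node, so the angle between them is the grid angle
    used in [Kmx]. *)
Lemma Kmx_shift (i : 'I_nt) :
  Kmx w1 w2 nt nr i i0 = expi (- (w * dot (x (shift_ord m.+1 i)) y)).
Proof.
by rewrite mxE radius_freq /x circ_shift_ord dot_polar addrK mulrA.
Qed.

(** Only the difference of the two angles matters, and a common shift cancels in it. *)
Lemma Cmx_shift (i j : 'I_nt) :
  Cmx R nt i j = (- dot (x (shift_ord m.+1 i)) (x (shift_ord m.+1 j)))%:C.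
Proof.
rewrite mxE /x !circ_shift_ord dot_circ; congr (- cos _)%:C.
by rewrite /angle -![_.+1%:R]natr1; ring.
Qed.

Lemma diag_sum (A : 'M[C]_nt) (K : 'M[C]_(nt, nr)) :
  (adj_mx K *m A *m K) i0 i0 = \sum_i \sum_j conjc (K i i0) * A i j * K j i0.
Proof.
rewrite mxE exchange_big /=; apply: eq_bigr => j _.
by rewrite mxE mulr_suml; apply: eq_bigr => i _; rewrite !mxE.
Qed.

Lemma phi2_sum (A : 'M[C]_nt) : phi2 w1 w2 w nr A 0 i0 =
  (4 * pi ^+ 2 / nt%:R ^+ 2)%:C * conjc (cw w) *
  \sum_i \sum_j conjc (Kmx w1 w2 nt nr i i0) * A i j * Kmx w1 w2 nt nr j i0.
Proof. by rewrite -diag_sum 2!mxE. Qed.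

Lemma phi1_sum (A : 'M[C]_nt) : phi1 w1 w2 w nr A 0 i0 =
  (4 * pi ^+ 2 / nt%:R ^+ 2)%:C * conjc (cw w) *
  \sum_i \sum_j conjc (Kmx w1 w2 nt nr i i0) * (Cmx R nt i j * A i j)
    * Kmx w1 w2 nt nr j i0.
Proof.
rewrite [LHS]mxE [X in _ * X]mxE diag_sum; congr (_ * _).
by apply: eq_bigr => i _; apply: eq_bigr => j _; rewrite [hadamard _ _ _ _]mxE.
Qed.

Lemma phase_combine (i j : 'I_nt) (c : C) :
  conjc (Kmx w1 w2 nt nr i i0) * c * Kmx w1 w2 nt nr j i0 =
  expi (w * dot (x (shift_ord m.+1 i) - x (shift_ord m.+1 j)) y) * c.
Proof.
rewrite !Kmx_shift conjc_expi opprK mulrAC -expiD; congr (expi _ * _).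
by rewrite dotBl mulrBr.
Qed.

Lemma phi2_entry :
  ((\matrix_(k < nt) phi2 w1 w2 w nr (shift_mx k.+1 (sample nt L)))
     *m Pfreq nr n' w1 w) m n =
  conjc (cw w) * ((4 * pi ^+ 2 / nt%:R ^+ 2)%:C *
  \sum_(i < nt) \sum_(j < nt) expi (w * dot (x i - x j) y) * L (x i) (x j)).
Proof.
rewrite (mul_Pfreq _ _ i0E) mxE phi2_sum mulrA [conjc _ * _]mulrC; congr (_ * _).
(* The right-hand sum is reindexed by the shift to match the shifted data on the left. *)
rewrite [RHS](reindex_inj (@shift_ord_inj nt m.+1)); apply: eq_bigr => i _.
rewrite [RHS](reindex_inj (@shift_ord_inj nt m.+1)); apply: eq_bigr => j _.
by rewrite phase_combine !mxE.
Qed.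

Lemma phi1_entry :
  ((\matrix_(k < nt) phi1 w1 w2 w nr (shift_mx k.+1 (sample nt L)))
     *m Pfreq nr n' w1 w) m n =
  - conjc (cw w) * ((4 * pi ^+ 2 / nt%:R ^+ 2)%:C *
  \sum_(i < nt) \sum_(j < nt)
    (dot (x i) (x j))%:C * expi (w * dot (x i - x j) y) * L (x i) (x j)).
Proof.
rewrite (mul_Pfreq _ _ i0E) mxE phi1_sum.
set S := (X in _ = _ * (_ * X)).
(* The sign in front of the adjoint moves into the sum, where it matches the sign carried by
   [Cmx]. *)
have -> : forall c d : C, - c * (d * S) = d * c * - S by move=> c d; ring.
congr (_ * _); rewrite /S -sumrN [RHS](reindex_inj (@shift_ord_inj nt m.+1)).
apply: eq_bigr => i _.
rewrite -sumrN [RHS](reindex_inj (@shift_ord_inj nt m.+1)); apply: eq_bigr => j _.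
by rewrite phase_combine Cmx_shift !mxE rmorphN /=; ring.
Qed.

End entries.

End matrix_entries.

(** * Kernels on the disc *)

Section disc_facts.
Variable R : realType.
Local Notation mu2 := (leb2 R).
Local Notation T2 := (measurableTypeR R * measurableTypeR R)%type.

Lemma measurable_disc : measurable (disc 1 : set T2).
Proof.
have mn : measurable_fun [set: T2] (fun y : T2 => y.1 ^+ 2 + y.2 ^+ 2 : R).
  by apply: measurable_funD; apply: measurable_funX;
    [exact: measurable_fst | exact: measurable_snd].
rewrite -[disc 1]setTI.
have -> : (disc 1 : set T2) = (fun y : T2 => y.1 ^+ 2 + y.2 ^+ 2 : R) @^-1` `]-oo, 1].
  by apply/seteqP; split => y; rewrite /disc /= in_itv /= expr1n.
exact: mn.
Qed.

Lemma mu2_disc_lty : (mu2 (disc 1) < +oo)%E.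
Proof.
have itv_lty : (@lebesgue_measure R `[(- 1)%R, 1%R] < +oo)%E.
  by rewrite lebesgue_measure_itv /=; case: ifP; rewrite -?EFinD ltry.
apply: (@le_lt_trans _ _ (mu2 (`[(- 1)%R, 1%R] `*` `[(- 1)%R, 1%R]))).
  apply: le_measure; rewrite ?inE.
  - exact: measurable_disc.
  - by apply: measurableX; exact: measurable_itv.
  - move=> [y1 y2]; rewrite /disc /= !in_itv /= expr1n => y12.
    by split; apply/andP; split; nra.
rewrite product_measure1E; try exact: measurable_itv.
by rewrite lte_mul_pinfty // ?ge0_fin_numE.
Qed.

End disc_facts.

(** * Lipschitz dependence of the kernels on the two angles *)

Section kernel_lipschitz.
Variable R : realType.
Implicit Types (a b w : R) (x y z u : R * R).

(** Cauchy-Schwarz, with the dot product written as the real part of [u] times the conjugate of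
    [y]. *)
Lemma dot_le_disc u y : disc 1 y -> `|dot u y| <= cabs (u.1 +i* u.2).
Proof.
rewrite /disc /= expr1n => y1.
have -> : dot u y = complex.Re ((u.1 +i* u.2) * (y.1 -i* y.2)).
  by rewrite /dot /= mulrN opprK.
rewrite (le_trans (Re_le_cabs _)) // cabsM ler_piMr ?cabs_ge0 //.
by rewrite cabsE /= sqrrN -[leRHS]sqrtr1 ler_wsqrtr.
Qed.

Lemma dot_circ_lipschitz a b y : disc 1 y -> `|dot (circ a - circ b) y| <= `|a - b|.
Proof.
move=> /dot_le_disc y1; apply: le_trans (y1 _) _.
by apply: le_trans (expi_lipschitz a b); rewrite /circ /polar /= !mul1r.
Qed.

Lemma cosX_lipschitz k a b : (k <= 2)%N -> `|cos a ^+ k - cos b ^+ k| <= `|a - b|.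
Proof.
case: k => [|[|[|//]]] _.
- by rewrite !expr0 subrr normr0.
- by rewrite !expr1 cos_lipschitz.
(* The double angle formula: the factor 1/2 offsets the doubled angle, so the constant stays 1. *)
have -> : cos a ^+ 2 - cos b ^+ 2 = (cos (a *+ 2) - cos (b *+ 2)) / 2.
  by rewrite (cos_mulr2n a) (cos_mulr2n b); field.
rewrite normrM [`|2^-1|]ger0_norm //.
have := cos_lipschitz (a *+ 2) (b *+ 2).
by rewrite -mulrnBl normrMn => ?; lra.
Qed.

(** Here [y] is the evaluation point of the adjoint and [y'] the integration variable on the disc.
    The power [k] counts the factors [x . z], one from [F1] and one from its adjoint. *)
Definition kernel k w y x z (y' : R * R) : R[i] :=
  (dot x z ^+ k)%:C * expi (w * dot (x - z) (y - y')).

Lemma norm_cosX_le1 k a : `|cos a ^+ k| <= 1.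
Proof. by rewrite normrX exprn_ile1 // cos_max. Qed.

Lemma cabs_kernel_le1 k w y a b y' : cabs (kernel k w y (circ a) (circ b) y') <= 1.
Proof. by rewrite cabsM cabs_expi mulr1 cabs_real dot_circ norm_cosX_le1. Qed.

(** The difference of products is split in two: the power of the cosine contributes 1 and the phase
    contributes [2 w]. *)
Lemma kernel_lipschitz k w y y' a b a0 b0 : (k <= 2)%N -> 0 <= w ->
  disc 1 y -> disc 1 y' ->
  cabs (kernel k w y (circ a) (circ b) y' - kernel k w y (circ a0) (circ b0) y') <=
  (1 + 2 * w) * (`|a - a0| + `|b - b0|).
Proof.
move=> k2 w0 y1 y'1; rewrite /kernel !dot_circ.
set s := w * _; set t := w * dot (circ a0 - _) _.
have -> : (cos (a - b) ^+ k)%:C * expi s - (cos (a0 - b0) ^+ k)%:C * expi t =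
    (cos (a - b) ^+ k - cos (a0 - b0) ^+ k)%:C * expi s +
    (cos (a0 - b0) ^+ k)%:C * (expi s - expi t) by rewrite rmorphB /=; ring.
rewrite mulrDl mul1r (le_trans (ler_cabsD _ _)) // lerD //.
  rewrite cabsM cabs_expi mulr1 cabs_real (le_trans (cosX_lipschitz _ _ k2)) //.
  by rewrite (_ : _ - _ - _ = (a - a0) - (b - b0)) ?ler_normB //; ring.
rewrite cabsM cabs_real (le_trans (ler_piMl (cabs_ge0 _) (norm_cosX_le1 _ _))) //.
apply: le_trans (expi_lipschitz _ _) _; rewrite -mulrBr normrM ger0_norm // mulrAC.
rewrite [leRHS]mulrC ler_wpM2l //.
(* Regrouping separates the increments in [a] and [b]; each is paired with both [y] and [y'], hence
   the factor 2. *)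
have -> : dot (circ a - circ b) (y - y') - dot (circ a0 - circ b0) (y - y') =
    dot (circ a - circ a0) y - dot (circ a - circ a0) y' -
    (dot (circ b - circ b0) y - dot (circ b - circ b0) y').
  by rewrite /dot /=; ring.
have := dot_circ_lipschitz a a0 y1; have := dot_circ_lipschitz a a0 y'1.
have := dot_circ_lipschitz b b0 y1; have := dot_circ_lipschitz b b0 y'1.
set p := dot _ y; set p' := dot _ y'; set q := dot _ y; set q' := dot _ y'.
move=> h1 h2 h3 h4.
apply: le_trans (ler_normB _ _) _.
have := ler_normB p p'; have := ler_normB q q'; lra.
Qed.

End kernel_lipschitz.

(** * Quadrature error *)

Section entry_error.
Variable R : realType.
Local Notation mu2 := (leb2 R).
Local Notation T2 := (measurableTypeR R * measurableTypeR R)%type.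
Variables (gamma eta : R * R -> R[i]).
Hypotheses (gamma_Linfty : Linfty (disc 1) gamma) (eta_Linfty : Linfty (disc 1) eta).
Implicit Types (w a b : R) (x y z : R * R).

Lemma Linfty_cintegrable (f : R * R -> R[i]) : Linfty (disc 1) f ->
  cintegrable (disc 1) f.
Proof.
move=> fL; have [mr mi _] := fL.
apply: integrable_cintegrable => //; first exact: measurable_disc.
by apply: Linfty_integrable => //; [exact: measurable_disc | exact: mu2_disc_lty].
Qed.

Lemma measurable_kernel_phase w y x z :
  measurable_fun (disc 1 : set T2) (fun y' : T2 => w * dot (x - z) (y - y') : R).
Proof.
apply: measurable_funTS; apply: measurable_funM; first exact: measurable_cst.
rewrite /dot; apply: measurable_funD; apply: measurable_funM;
  do ?exact: measurable_cst; apply: measurable_funB; do ?exact: measurable_cst.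
- exact: measurable_fst.
- exact: measurable_snd.
Qed.

Lemma kernel_cintegrable k w y a b (f : R * R -> R[i]) : Linfty (disc 1) f ->
  cintegrable (disc 1) (fun y' => kernel k w y (circ a) (circ b) y' * f y').
Proof.
move=> fL; apply: (cintegrable_boundedM (M := 1)).
- exact: measurable_disc.
- exact: Linfty_cintegrable.
- under eq_fun do rewrite /kernel Re_mulc /= mul0r subr0.
  apply: measurable_funM; first exact: measurable_cst.
  apply: measurableT_comp (measurable_kernel_phase _ _ _ _).
  exact: continuous_measurable_fun (@continuous_cos R).
- under eq_fun do rewrite /kernel Im_mulc /= mul0r addr0.
  apply: measurable_funM; first exact: measurable_cst.
  apply: measurableT_comp (measurable_kernel_phase _ _ _ _).
  exact: continuous_measurable_fun (@continuous_sin R).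
- by move=> y' _; exact: cabs_kernel_le1.
Qed.

(** The adjoint integrand with the factor [cw w] removed: [k = 0] belongs to [F2adj], [k = 1] to
    [F1adj]. The minus sign is that of [F1]. *)
Definition kernel_integral k w y a b : R[i] :=
  cintegral (disc 1) (fun y' => kernel k w y (circ a) (circ b) y' * eta y' -
                                kernel k.+1 w y (circ a) (circ b) y' * gamma y').

(* Multiplying the data by [(x . z)^k e^{i w (x - z) . y}] shifts the phase of
   both integrands and raises the powers of [x . z], from 1 and 0 to k + 1 and k. *)
Lemma forward_kernel k w y a b : let x := circ a in let z := circ b in
  (dot x z ^+ k)%:C * expi (w * dot (x - z) y) *
    (F1 (disc 1) w gamma x z + F2 (disc 1) w eta x z) =
  cw w * kernel_integral k w y a b.
Proof.
move=> x z; have md := @measurable_disc R.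
have kE j y' : kernel (k + j) w y x z y' =
    (dot x z ^+ k)%:C * expi (w * dot (x - z) y) * kernel j w 0 x z y'.
  rewrite /kernel exprD rmorphM /= mulrACA -expiD -mulrDr; congr (_ * expi (_ * _)).
  by rewrite /dot /=; ring.
have shift j (f : R * R -> R[i]) : Linfty (disc 1) f ->
    cintegral (disc 1) (fun y' => kernel (k + j) w y x z y' * f y') =
    (dot x z ^+ k)%:C * expi (w * dot (x - z) y) *
    cintegral (disc 1) (fun y' => kernel j w 0 x z y' * f y').
  move=> fL; rewrite -cintegralZ //; last exact: kernel_cintegrable.
  by apply: eq_cintegral => y' _; rewrite kE -!mulrA.
(* The forward operators are the kernel integrals at [y = 0], with power 1 for [gamma] and 0 for
   [eta]. *)
have F1E : F1 (disc 1) w gamma x z =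
    - cw w * cintegral (disc 1) (fun y' => kernel 1 w 0 x z y' * gamma y').
  congr (_ * _); apply: eq_cintegral => y' _; rewrite /kernel expr1.
  by congr (_ * expi _ * _); rewrite /dot /=; ring.
have F2E : F2 (disc 1) w eta x z =
    cw w * cintegral (disc 1) (fun y' => kernel 0 w 0 x z y' * eta y').
  congr (_ * _); apply: eq_cintegral => y' _; rewrite /kernel expr0 mul1r.
  by congr (expi _ * _); rewrite /dot /=; ring.
rewrite F1E F2E /kernel_integral cintegralB //; do ?exact: kernel_cintegrable.
have := shift 1%N gamma gamma_Linfty; have := shift 0%N eta eta_Linfty.
by rewrite addn0 addn1 => -> ->; ring.
Qed.

(** The kernel bound passes under the integral. Since power [k.+1] occurs, [k <= 1] keeps the powers
    within 2. *)
Lemma kernel_integral_lipschitz k w y a b a0 b0 : (k <= 1)%N -> 0 <= w -> disc 1 y ->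
  cabs (kernel_integral k w y a b - kernel_integral k w y a0 b0) <=
  (1 + 2 * w) * (L1norm (disc 1) eta + L1norm (disc 1) gamma) *
  (`|a - a0| + `|b - b0|).
Proof.
move=> k1 w0 y1; have md := @measurable_disc R.
have ik j c d f : Linfty (disc 1) f ->
    cintegrable (disc 1) (fun y' => kernel j w y (circ c) (circ d) y' * f y').
  exact: kernel_cintegrable.
have nint f : Linfty (disc 1) f ->
    mu2.-integrable (disc 1) (EFin \o (fun y' => cabs (f y'))).
  by move=> fL; apply: Linfty_integrable => //; exact: mu2_disc_lty.
set d := `|a - a0| + `|b - b0|; set C := (1 + 2 * w) * d.
rewrite /kernel_integral -cintegralB //; do ?by apply: cintegrableB => //; exact: ik.
have -> : (1 + 2 * w) * (L1norm (disc 1) eta + L1norm (disc 1) gamma) * d =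
    \int[mu2]_(y' in disc 1) (C * cabs (eta y') + C * cabs (gamma y')).
  by rewrite Rintegral_lincomb //; [rewrite !L1normE /C; ring | exact: nint..].
apply: cabs_cintegral_le => //.
- by apply: cintegrableB => //; apply: cintegrableB => //; exact: ik.
- by apply: integrable_lincomb => //; exact: nint.
move=> y' y'1.
set p := kernel k _ _ _ _ _; set q := kernel k.+1 _ _ _ _ _.
set p0 := kernel k _ _ _ _ _; set q0 := kernel k.+1 _ _ _ _ _.
have -> : p * eta y' - q * gamma y' - (p0 * eta y' - q0 * gamma y') =
    (p - p0) * eta y' - (q - q0) * gamma y' by ring.
rewrite (le_trans (ler_cabsB _ _)) // !cabsM.
by rewrite lerD // ler_wpM2r ?cabs_ge0 // kernel_lipschitz // (leq_trans k1).
Qed.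

(** Treats both adjoints at once, [c] being the conjugate of [cw w] up to sign. One factor
    [cabs (cw w)] comes from [c], the other from the data. *)
Lemma frequency_error k w y nt (c : R[i]) (g : R * R -> R * R -> R[i]) :
  (k <= 1)%N -> 0 <= w -> disc 1 y -> (0 < nt)%N -> cabs c = cabs (cw w) ->
  (forall x z, g x z = (dot x z ^+ k)%:C * expi (w * dot (x - z) y) *
    (F1 (disc 1) w gamma x z + F2 (disc 1) w eta x z)) ->
  cabs (c * circ2_integral g - c * ((4 * pi ^+ 2 / nt%:R ^+ 2)%:C *
    \sum_(i < nt) \sum_(j < nt)
      g (circ (angle R nt i.+1)) (circ (angle R nt j.+1)))) <=
  16 * pi ^+ 3 * (1 + 2 * w) * cabs (cw w) ^+ 2 *
    (L1norm (disc 1) eta + L1norm (disc 1) gamma) / nt%:R.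
Proof.
move=> k1 w0 y1 nt0 cE gE.
pose F a b := cw w * kernel_integral k w y a b.
have gF a b : g (circ a) (circ b) = F a b by rewrite gE forward_kernel.
have -> : circ2_integral g =
    cintegral (`[0, 2 * pi] `*` `[0, 2 * pi]) (fun p => F p.1 p.2).
  by apply: eq_cintegral => p _; exact: gF.
under eq_bigr do under eq_bigr do rewrite gF.
pose L := cabs (cw w) *
  ((1 + 2 * w) * (L1norm (disc 1) eta + L1norm (disc 1) gamma)).
have N0 f : 0 <= L1norm (disc 1) f :> R.
  by rewrite fine_ge0 // Lnorm_ge0.
have L0 : 0 <= L.
  by rewrite !mulr_ge0 ?cabs_ge0 ?addr_ge0 ?mulr_ge0.
have FL a b a0 b0 : cabs (F a b - F a0 b0) <= L * (`|a - a0| + `|b - b0|).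
  rewrite /F -mulrBr cabsM /L -mulrA ler_wpM2l ?cabs_ge0 //.
  exact: kernel_integral_lipschitz.
rewrite -mulrBr cabsM cE.
apply: le_trans (ler_wpM2l (cabs_ge0 _) (quadrature_error nt0 L0 FL)) _.
by rewrite /L [leLHS](_ : _ = 16 * pi ^+ 3 * (1 + 2 * w) * cabs (cw w) ^+ 2 *
    (L1norm (disc 1) eta + L1norm (disc 1) gamma) / nt%:R) //; ring.
Qed.

Lemma F1adj_error w y nt (f : R * R -> R * R -> R[i]) :
  0 <= w -> disc 1 y -> (0 < nt)%N ->
  (forall x z, f x z = F1 (disc 1) w gamma x z + F2 (disc 1) w eta x z) ->
  cabs (F1adj w f y - - conjc (cw w) * ((4 * pi ^+ 2 / nt%:R ^+ 2)%:C *
    \sum_(i < nt) \sum_(j < nt)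
      (dot (circ (angle R nt i.+1)) (circ (angle R nt j.+1)))%:C *
      expi (w * dot (circ (angle R nt i.+1) - circ (angle R nt j.+1)) y) *
      f (circ (angle R nt i.+1)) (circ (angle R nt j.+1)))) <=
  16 * pi ^+ 3 * (1 + 2 * w) * cabs (cw w) ^+ 2 *
    (L1norm (disc 1) eta + L1norm (disc 1) gamma) / nt%:R.
Proof.
move=> w0 y1 nt0 fE.
apply: (@frequency_error 1 w y nt (- conjc (cw w))
  (fun x z => (dot x z)%:C * expi (w * dot (x - z) y) * f x z)) => //.
- by rewrite cabsN cabs_conjc.
- by move=> x z; rewrite expr1 fE.
Qed.

Lemma F2adj_error w y nt (f : R * R -> R * R -> R[i]) :
  0 <= w -> disc 1 y -> (0 < nt)%N ->
  (forall x z, f x z = F1 (disc 1) w gamma x z + F2 (disc 1) w eta x z) ->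
  cabs (F2adj w f y - conjc (cw w) * ((4 * pi ^+ 2 / nt%:R ^+ 2)%:C *
    \sum_(i < nt) \sum_(j < nt)
      expi (w * dot (circ (angle R nt i.+1) - circ (angle R nt j.+1)) y) *
      f (circ (angle R nt i.+1)) (circ (angle R nt j.+1)))) <=
  16 * pi ^+ 3 * (1 + 2 * w) * cabs (cw w) ^+ 2 *
    (L1norm (disc 1) eta + L1norm (disc 1) gamma) / nt%:R.
Proof.
move=> w0 y1 nt0 fE.
apply: (@frequency_error 0 w y nt (conjc (cw w))
  (fun x z => expi (w * dot (x - z) y) * f x z)) => //.
- by rewrite cabs_conjc.
- by move=> x z; rewrite expr0 mul1r fE.
Qed.

End entry_error.

(** * Assembly of the entrywise bounds *)

Lemma max_entry_le (R : realType) m n (A : 'M[R[i]]_(m, n)) (B : R) : 0 <= B ->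
  (forall i j, cabs (A i j) <= B) -> max_entry A <= B.
Proof.
move=> B0 AB; rewrite /max_entry.
have maxB (I : finType) (f : I -> R) : (forall i, f i <= B) ->
    \big[Num.max/0]_i f i <= B.
  by move=> fB; elim/big_ind: _ => // x y xB yB; rewrite ge_max xB.
by apply: (maxB) => i; apply: (maxB) => j.
Qed.

(** With [q = w / w1], the index [q * n.+1] is positive and at most [w2 / w1 * n'], which equals
    [nr]; the ordinal is its predecessor. *)
Lemma frequency_index (R : realType) (w1 w2 w : R) nr n' (n : 'I_n') :
  0 < w1 -> w1 <= w -> w <= w2 -> w / w1 \is a Num.nat -> n'%:R = w1 / w2 * nr%:R ->
  exists i : 'I_nr, i.+1%:R = w / w1 * n.+1%:R :> R.
Proof.
move=> w1_gt0 w1w ww2 /natrP[q qE] n'E.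
have w2_gt0 : 0 < w2 by rewrite (lt_le_trans w1_gt0) // (le_trans w1w).
have q_gt0 : (0 < q)%N.
  by rewrite -(ltr_nat R) -qE divr_gt0 // (lt_le_trans w1_gt0).
have lt_nr : ((q * n.+1).-1 < nr)%N.
  rewrite prednK ?muln_gt0 ?q_gt0 // -(ler_nat R) natrM -qE.
  have nn' : n.+1%:R <= n'%:R :> R by rewrite ler_nat.
  have -> : nr%:R = w2 / w1 * n'%:R :> R.
    by rewrite n'E; field; rewrite !gt_eqF.
  by rewrite ler_pM ?divr_ge0 ?ler_wpM2r ?invr_ge0 // ltW // (lt_le_trans w1_gt0).
by exists (Ordinal lt_nr); rewrite /= prednK ?muln_gt0 ?q_gt0 // natrM qE.
Qed.

Lemma polar_disc (R : realType) (t r : R) : 0 <= r -> r <= 1 -> disc 1 (polar t r).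
Proof.
move=> r0 r1; rewrite /disc /polar /= !exprMn -mulrDr cos2Dsin2 mulr1.
by rewrite lerXn2r // nnegrE.
Qed.

Theorem theorem3p1 (R : realType) (w1 w2 : R) (nt nr n' : nat)
    (gamma eta : R * R -> R[i])
    (w1_gt0 : 0 < w1) (w1_lt_w2 : w1 < w2) (w21_nat : w2 / w1 \is a Num.nat)
    (nt_gt0 : (0 < nt)%N) (nt_le_nr : (nt <= nr)%N)
    (n'E : n'%:R = w1 / w2 * nr%:R)
    (gamma_Linfty : Linfty (disc 1) gamma) (eta_Linfty : Linfty (disc 1) eta) :
  let Lam := forward (disc 1) w1 w2 gamma eta in
  let Phi := discr_output w1 w2 nt nr n' (adjoint w1 w2 Lam) in
  let LamD := discr_input nt Lam in
  exists N : network R[i] ((nt + nt) * nt) ((nt + nt) * n'),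
    (forall L : 'M[R[i]]_(nt + nt, nt), run_mx N L = phi0 w1 w2 nr n' L) /\
    max_entry (Phi - run_mx N LamD) <= cbf0 w1 w2 gamma eta / nt%:R.
Proof.
move=> Lam Phi LamD.
have [N NE] := linear_network (@phi0_linear R w1 w2 nt nr n').
exists N; split => //; rewrite NE.
have w2_gt0 : 0 < w2 by exact: lt_trans w1_lt_w2.
have w1_neq0 : w1 != 0 by rewrite gt_eqF.
have nr_gt0 : (0 < nr)%N by exact: leq_trans nt_le_nr.
have w11_nat : w1 / w1 \is a Num.nat by rewrite divff // rpred1.
pose M := L1norm (disc 1) eta + L1norm (disc 1) gamma.
have M0 : 0 <= M by rewrite addr_ge0 // fine_ge0 // Lnorm_ge0.
pose err w := 16 * pi ^+ 3 * (1 + 2 * w) * cabs (cw w) ^+ 2 * M / nt%:R.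
have err_ge0 w : 0 < w -> 0 <= err w.
  move=> w0; rewrite /err divr_ge0 // mulr_ge0 // mulr_ge0 ?exprn_ge0 ?cabs_ge0 //.
  by rewrite mulr_ge0 ?mulr_ge0 ?exprn_ge0 ?pi_ge0 //; lra.
(* Each frequency satisfies [2 * (1 + 2 * w) <= 4 * w2 + 3], and 16 is 8 times 2. *)
have err_le : err w1 + err w2 <= cbf0 w1 w2 gamma eta / nt%:R.
  rewrite /err -mulrDl ler_wpM2r ?invr_ge0 // /cbf0 -/M -mulrDl ler_wpM2r //.
  rewrite [leRHS]mulrDr lerD // ler_wpM2r ?exprn_ge0 ?cabs_ge0 //;
    rewrite -!mulrA; have := exprn_ge0 3 (pi_ge0 R); nra.
apply: max_entry_le.
  by apply: le_trans err_le; rewrite addr_ge0 // err_ge0.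
move=> i n; apply: le_trans err_le.
have rho0 : 0 <= Defs.radius w1 w2 nr n.+1.
  by rewrite mulr_ge0 // divr_ge0 // ltW.
(* The radius of index [n'] is exactly 1, and the radii increase with the index. *)
have rho1 : Defs.radius w1 w2 nr n.+1 <= 1.
  have -> : 1 = Defs.radius w1 w2 nr n'.
    rewrite /Defs.radius n'E; field.
    by rewrite w1_neq0 (gt_eqF w2_gt0) pnatr_eq0 -lt0n nr_gt0.
  rewrite ler_wpM2l ?divr_ge0 ?(ltW w1_gt0) ?(ltW w2_gt0) //.
  by rewrite ler_wpM2r ?invr_ge0 // ler_nat.
have [i1 i1E] := frequency_index n w1_gt0 (lexx w1) (ltW w1_lt_w2) w11_nat n'E.
have [i2 i2E] := frequency_index n w1_gt0 (ltW w1_lt_w2) (lexx w2) w21_nat n'E.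
rewrite phi0_discr_input /phi0_freq !embed_upper_lower /Phi /discr_output.
rewrite !add_col_mx opp_col_mx add_col_mx.
have entryE (A B D : 'M[R[i]]_(nt, n')) m :
    (A - (B + D)) m n = A m n - (B m n + D m n) by rewrite !mxE.
have split_le (u1 u2 v1 v2 : R[i]) : cabs (u1 - v1) <= err w1 ->
    cabs (u2 - v2) <= err w2 -> cabs (u1 + u2 - (v1 + v2)) <= err w1 + err w2.
  move=> h1 h2; have -> : u1 + u2 - (v1 + v2) = (u1 - v1) + (u2 - v2) by ring.
  by rewrite (le_trans (ler_cabsD _ _)) // lerD.
have y1 (m : 'I_nt) :
    disc 1 (polar (angle R nt m.+1) (Defs.radius w1 w2 nr n.+1)).
  exact: polar_disc.
(* Upper rows compare [phi1] with [F1adj], lower rows [phi2] with [F2adj]. *)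
case: (split_ordP i) => m ->; rewrite ?col_mxEu ?col_mxEd entryE [X in X - _]mxE.
- rewrite (phi1_entry w2 Lam.1 m i1E w1_neq0) (phi1_entry w2 Lam.2 m i2E w1_neq0).
  have e w f w0 := @F1adj_error R gamma eta gamma_Linfty eta_Linfty w _ nt f
    (ltW w0) (y1 m) nt_gt0.
  by apply: (split_le); [exact: (e w1 Lam.1) | exact: (e w2 Lam.2)].
- rewrite (phi2_entry w2 Lam.1 m i1E w1_neq0) (phi2_entry w2 Lam.2 m i2E w1_neq0).
  have e w f w0 := @F2adj_error R gamma eta gamma_Linfty eta_Linfty w _ nt f
    (ltW w0) (y1 m) nt_gt0.
  by apply: (split_le); [exact: (e w1 Lam.1) | exact: (e w2 Lam.2)].
Qed.
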